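(* Let $V_0>0$. Consider a double linear policy with $\alpha\in(0,1)$ and weights $w(k)\in\mathcal{W}$ for all $k$. Then the variance of the cumulative gain-loss function is given by $$\begin{aligned} \mathrm{var}(\mathcal{G}(\alpha,\boldsymbol{w},k,X)) = V_0^2\Bigg(&\alpha^2\prod_{j=0}^{k-1}\Big(w(j)^2\sigma^2+(1+w(j)\mu)^2\Big)+(1-\alpha)^2\prod_{j=0}^{k-1}\Big(w(j)^2\sigma^2+(1-w(j)\mu)^2\Big)\\ &+2\alpha(1-\alpha)\prod_{j=0}^{k-1}\Big(1-w(j)^2(\sigma^2+\mu^2)\Big)-2\alpha(1-\alpha)\prod_{j=0}^{k-1}\big(1-w(j)^2\mu^2\big)\\ &-\alpha^2\prod_{j=0}^{k-1}(1+w(j)\mu)^2-(1-\alpha)^2\prod_{j=0}^{k-1}(1-w(j)\mu)^2\Bigg). \end{aligned}$$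
   Context: Setting. For stages $k=0,1,2,\dots$, a risky asset has price $S(k)>0$ and per-period return $X(k):=\frac{S(k+1)-S(k)}{S(k)}$. With probability one $X(k)\in[X_{\min},X_{\max}]$ for all $k$, with known bounds $-1<X_{\min}<0<X_{\max}<\infty$ that are in the support of $X(k)$. The returns $X(k)$ are independent with common mean $\mathbb{E}[X(k)]=\mu\in\mathbb{R}$ and common variance $\mathrm{var}(X(k))=\sigma^2>0$ for all $k$. Trades incur zero transaction costs, the asset is perfectly liquid, and the riskless rate is taken to be $0$. Admissible weights: $\mathcal{W}:=[0,w_{\max}]$ with $w_{\max}:=\min\{1,1/X_{\max}\}$. The weighting function satisfies $w(k)\in\mathcal{W}$ for all $k$, may vary with $k$, and is assumed to be causal; i.e., it may depend only on the information up to stage $k-1$. Write $\boldsymbol{w}:=\{w(j)\}_{j=0}^{k-1}$. Double linear policy: the initial account value $V_0>0$ is split as $V_L(0):=\alpha V_0$ (long) and $V_S(0):=(1-\alpha)V_0$ (short). The policy is $\pi(k):=\pi_L(k)+\pi_S(k)$ with $\pi_L(k)=w(k)V_L(k)$ and $\pi_S(k)=-w(k)V_S(k)$, and the account values evolve as $V_L(k+1)=V_L(k)+X(k)\pi_L(k)$ and $V_S(k+1)=V_S(k)+X(k)\pi_S(k)$. The overall account value is $V(k)=V_L(k)+V_S(k)=V_0(\alpha R_+(k)+(1-\alpha)R_-(k))$, where $R_+(k):=\prod_{j=0}^{k-1}(1+w(j)X(j))$ and $R_-(k):=\prod_{j=0}^{k-1}(1-w(j)X(j))$. For $k>0$, the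 cumulative gain-loss function up to stage $k$ is $\mathcal{G}(\alpha,\boldsymbol{w},k,X):=V(k)-V_0$ with $X:=\{X(j)\}_{j=0}^{k-1}$.
   Formalization: The weights w(k) are taken to be deterministic (possibly varying with k); for causal weights depending on past returns the right-hand side would be a random variable while the variance is a number, so the formula would be ill-defined. *)

(* Defs.v *)
From HB Require Import structures.
From mathcomp Require Import all_boot all_order all_algebra finmap.
From mathcomp Require Import all_classical all_reals all_analysis.
Set Implicit Arguments.
Unset Strict Implicit.
Unset Printing Implicit Defensive.
Import Order.TTheory GRing.Theory Num.Theory.
Import numFieldNormedType.Exports.
Local Open Scope classical_set_scope.
Local Open Scope ring_scope.

Section Probability.
Context {d : measure_display} {T : measurableType d} {R : realType}.
Variable P : probability T R.

(* Taking [A i = setT] outside of [J] makes it harmless to ask for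
   measurability of all the [A i]. *)
Definition mutually_independent (I : choiceType) (X : I -> {RV P >-> R}) :
    Prop :=
  forall (J : {fset I}) (A : I -> set R), (forall i, measurable (A i)) ->
    P (\bigcap_(i in [set` J]) (X i @^-1` A i)) =
    (\prod_(i <- J) P (X i @^-1` A i))%E.

(* Topological support of the law of [X]. *)
Definition support_RV (X : {RV P >-> R}) : set R :=
  [set x | forall U : set R, open U -> U x -> (0 < distribution P X U)%E].

End Probability.

Section DoubleLinearPolicy.
Context {R : realType}.
Implicit Types (w x S : nat -> R) (k : nat).

Definition per_period_return S k : R := (S k.+1 - S k) / S k.

Definition max_weight (Xmax : R) : R := Num.min 1 (1 / Xmax).

Definition admissible_weights (Xmax : R) : set R :=
  [set` `[0, max_weight Xmax]].

(* [V_L(k+1) = V_L(k) + X(k) pi_L(k)] with [pi_L(k) = w(k) V_L(k)];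
   [x] is one realization of the returns. *)
Fixpoint long_account (V0 alpha : R) w x k : R :=
  if k is j.+1 then
    let V := long_account V0 alpha w x j in V + x j * (w j * V)
  else alpha * V0.

(* [V_S(k+1) = V_S(k) + X(k) pi_S(k)] with [pi_S(k) = - w(k) V_S(k)]. *)
Fixpoint short_account (V0 alpha : R) w x k : R :=
  if k is j.+1 then
    let V := short_account V0 alpha w x j in V + x j * (- w j * V)
  else (1 - alpha) * V0.

Definition account_value (V0 alpha : R) w x k : R :=
  long_account V0 alpha w x k + short_account V0 alpha w x k.

Definition gain_loss (V0 alpha : R) w k x : R :=
  account_value V0 alpha w x k - V0.

End DoubleLinearPolicy.

(* Main.v *)
Require Import Defs.
From HB Require Import structures.
From mathcomp Require Import all_boot all_order all_algebra finmap.
From mathcomp Require Import all_classical all_reals all_analysis.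
From mathcomp Require Import measurable_realfun ring lra.
Set Implicit Arguments.
Unset Strict Implicit.
Unset Printing Implicit Defensive.
Import Order.TTheory GRing.Theory Num.Theory.
Import numFieldNormedType.Exports.
Local Open Scope classical_set_scope.
Local Open Scope ring_scope.

(** Up to their initial values, the long and the short account are the products
    [A] and [B] of the growth factors [1 + w j * X j] and [1 - w j * X j], so the gain is an affine combination
    of [A] and [B], and its variance is a combination of [V(A)], [V(B)] and
    [Cov(A, B)].  All three are covariances of two products of growth factors
    with deterministic weights [a] and [b], and by independence
    [E(prod (1 + a j X j) (1 + b j X j))] is the product over [j] of
    [E((1 + a j X j) (1 + b j X j))
       = 1 + (a j + b j) mu + a j b j (sigma^2 + mu^2)].
    Taking [a] and [b] among [w], [- w] and [0] gives the second moments, the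
    cross moment and the means of [A] and [B], hence the three covariances
    ([covariance_growth]).

    The analytic content is that independence, a statement about events,
    makes the expectation of a product the product of the expectations
    ([ge0_expectation_prod]).  It suffices to prove this for nonnegative
    functions: the bounds on the returns and on the weights force every
    growth factor to be nonnegative almost surely
    ([admissible_growth_factor_ge0]), so the factors can be replaced by their
    absolute values.  The independence hypothesis is the case of indicators,
    from which one passes to general functions one factor at a time, by
    simple functions and monotone convergence ([ge0_integral_factor]). *)

(** * Extending a product formula from indicators to functions *)

Section Factorization.
Context {d : measure_display} {T : measurableType d} {R : realType}.
Import HBNNSimple.

(** The weight [K] makes this apply to both sides of [ge0_integral_factor]:
    with [K] the remaining factors on the left, and [K = 1] on the right. *)
Lemma cvg_integral_weighted_comp (mu : {measure set T -> \bar R})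
    (K Y : T -> R) (f : R -> R) (f_ : {nnsfun R >-> R}^nat) :
  measurable_fun setT K -> (forall t, 0 <= K t) -> measurable_fun setT Y ->
  nondecreasing_seq (f_ : (R -> R)^nat) ->
  (forall y, f_ n y @[n --> \oo] --> f y) ->
  (\sum_(y \in range (f_ n))
     y%:E * \int[mu]_t (K t * \1_(f_ n @^-1` [set y]) (Y t))%:E @[n --> \oo]
   --> \int[mu]_t (K t * f (Y t))%:E)%E.
Proof.
move=> mK K0 mY ndf cvgf.
have mKh (h : R -> R) : measurable_fun [set: R] h ->
    measurable_fun [set: T] (fun t => K t * h (Y t)).
  move=> mh; apply: measurable_funM => //.
  exact: measurableT_comp.
have -> : (\int[mu]_t (K t * f (Y t))%:E =
    \int[mu]_t limn (fun n => (K t * f_ n (Y t))%:E))%E.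
  apply: eq_integral => t _; apply/esym/cvg_lim => //.
  apply: cvg_EFin; first exact: nearW.
  by rewrite /comp/=; apply: cvgM; [exact: cvg_cst|exact: cvgf].
rewrite [X in X @ _ --> _](_ : _ =
    (fun n => \int[mu]_t (K t * f_ n (Y t))%:E)%E); last first.
  apply/funext => n.
  under [RHS]eq_integral => t _.
    rewrite fimfunE EFinM -fsumEFin// ge0_mule_fsumr; last first.
      by move=> r; rewrite EFinM nnfun_muleindic_ge0.
    over.
  rewrite ge0_integral_fsum//; last 2 first.
  - move=> r; under eq_fun do rewrite -EFinM.
    apply/measurable_EFinP/(mKh (fun y => r * \1_(f_ n @^-1` [set r]) y)).
    by apply: measurable_funM => //; exact: measurable_indic.
  - move=> r t _; apply: mule_ge0; first by rewrite lee_fin.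
    by rewrite EFinM nnfun_muleindic_ge0.
  apply: eq_fsbigr => y _.
  under [RHS]eq_integral do rewrite -EFinM mulrCA EFinM.
  (* A scalar [y >= 0] comes out of the integral; for [y < 0] the level set is
     empty and both sides vanish. *)
  have [y0|y0] := ltP y 0.
    rewrite preimage_nnfun0//.
    under eq_integral do rewrite indic0 mulr0.
    under [in RHS]eq_integral do rewrite indic0 mulr0 mule0.
    by rewrite integral0 mule0.
  rewrite ge0_integralZl//.
  - apply/measurable_EFinP/(mKh (\1_(f_ n @^-1` [set y]))).
    exact: measurable_indic.
  - by move=> t _; rewrite lee_fin mulr_ge0.
apply: cvg_monotone_convergence => //.
- by move=> n; exact/measurable_EFinP/mKh.
- by move=> n t _; rewrite lee_fin mulr_ge0.
- by move=> t _ m n mn; rewrite lee_fin ler_wpM2l//; exact/lefP/ndf.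
Qed.

(** Both sides are limits, along simple functions increasing to [f], of linear
    combinations of the indicator case.  Finiteness of [c] lets multiplication
    by [c] commute with the limit. *)
Lemma ge0_integral_factor (mu : {measure set T -> \bar R})
    (G Y : T -> R) (c : \bar R) :
  measurable_fun setT G -> (forall t, 0 <= G t) -> measurable_fun setT Y ->
  c \is a fin_num ->
  (forall A, measurable A ->
    \int[mu]_t (G t * \1_A (Y t))%:E = c * \int[mu]_t (\1_A (Y t))%:E)%E ->
  forall f : R -> R, measurable_fun setT f -> (forall y, 0 <= f y) ->
  (\int[mu]_t (G t * f (Y t))%:E = c * \int[mu]_t (f (Y t))%:E)%E.
Proof.
move=> mG G0 mY cfin GA f mf f0.
have mEf : measurable_fun [set: R] (EFin \o f : R -> \bar R).
  exact/measurable_EFinP.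
pose f_ := nnsfun_approx measurableT mEf.
have ndf : nondecreasing_seq (f_ : (R -> R)^nat) by exact: nd_nnsfun_approx.
have cvgf y : f_ n y @[n --> \oo] --> f y.
  have Ef0 x : [set: R] x -> (0 <= (EFin \o f) x)%E by rewrite lee_fin.
  exact: fine_cvg (cvg_nnsfun_approx measurableT mEf Ef0 (x := y) I).
have cvgG := cvg_integral_weighted_comp (mu := mu) mG G0 mY ndf cvgf.
have m1 : measurable_fun [set: T] (cst (1 : R)) by [].
have /(cvgeZl cfin) cvg1 :=
  cvg_integral_weighted_comp (mu := mu) m1 (fun=> ler01) mY ndf cvgf.
have -> : (\int[mu]_t (f (Y t))%:E = \int[mu]_t (cst 1%R t * f (Y t))%:E)%E.
  by apply: eq_integral => t _; rewrite mul1r.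
apply: cvg_unique cvgG _ => //; apply: cvg_trans cvg1.
apply: near_eq_cvg; near=> n.
rewrite ge0_mule_fsumr; last first.
  move=> y; have [y0|y0] := ltP y 0.
    rewrite preimage_nnfun0// integral0_eq ?mule0// => t _.
    by rewrite indic0 mulr0.
  by rewrite mule_ge0 ?lee_fin ?integral_ge0// => t _; rewrite lee_fin mulr_ge0.
apply: eq_fsbigr => y _; rewrite GA// muleCA.
by under eq_integral do rewrite mul1r.
Unshelve. all: by end_near. Qed.
End Factorization.

(** * Expectation of a product of independent variables *)

Section ExpectationProduct.
Context {d : measure_display} {T : measurableType d} {R : realType}.
Variable P : probability T R.

Lemma indic_bigcap_prod (I : choiceType) (J : {fset I}) (B : I -> set T) t :
  \1_(\bigcap_(i in [set` J]) B i) t = \prod_(i <- J) \1_(B i) t :> R.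
Proof.
have [Bt|nBt] := pselect ((\bigcap_(i in [set` J]) B i) t).
  rewrite indicE mem_set// big1_seq// => i /andP[_ iJ].
  by rewrite indicE mem_set//; exact: Bt.
rewrite indicE memNset//; apply/esym/eqP; rewrite prodf_seq_eq0.
move: nBt => /existsNP[i /not_implyP[iJ nBi]].
by apply/hasP; exists i => //=; rewrite indicE memNset.
Qed.

(** Induction on a list [s] of indices outside which all factors are
    indicators.  For empty [s] the formula is the definition of independence.
    To add [i] to [s], fix the other factors: by the induction hypothesis the
    formula holds whenever the [i]-th factor is an indicator, hence for every
    nonnegative measurable factor by [ge0_integral_factor]. *)
Lemma ge0_expectation_prod (I : choiceType) (X : I -> {RV P >-> R})
    (J : {fset I}) (f : I -> R -> R) :
  mutually_independent X ->
  (forall i, measurable_fun [set: R] (f i)) -> (forall i y, 0 <= f i y) ->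
  (forall i, i \in J -> 'E_P[f i \o X i] \is a fin_num)%E ->
  ('E_P[fun t => (\prod_(i <- J) f i (X i t))%R] =
   \prod_(i <- J) 'E_P[f i \o X i])%E.
Proof.
move=> indX mf f0 finf.
have EE (Y : T -> R) : ('E_P[Y] = \int[P]_t (Y t)%:E)%E by rewrite unlock.
have mX i A : measurable A -> measurable (X i @^-1` A).
  by move=> mA; rewrite -[X in measurable X]setTI; exact: measurable_funP.
suff prod_off (s : seq I) : forall g : I -> R -> R,
    (forall i, measurable_fun [set: R] (g i)) -> (forall i y, 0 <= g i y) ->
    (forall i, i \in J -> 'E_P[g i \o X i] \is a fin_num)%E ->
    (forall i, i \in J -> i \notin s ->
       exists2 A, measurable A & g i = \1_A) ->
    ('E_P[fun t => (\prod_(i <- J) g i (X i t))%R] =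
     \prod_(i <- J) 'E_P[g i \o X i])%E.
  by apply: (prod_off (enum_fset J)) => // i ->.
elim: s => [|i s IHs] g mg g0 fing indicg.
  have /choice[A AP] i : exists A, measurable A /\ (i \in J -> g i = \1_A).
    have [/indicg|iJ] := boolP (i \in J); last by exists set0.
    by move=> /(_ isT)[A mA ->]; exists A.
  have mA i : measurable (X i @^-1` A i).
    by apply: mX; case: (AP i).
  under eq_fun => t.
    rewrite (eq_big_seq (fun i => \1_(X i @^-1` A i) t)); last first.
      by move=> i iJ; rewrite (AP i).2// !indicE.
    rewrite -indic_bigcap_prod; over.
  rewrite -[X in ('E_P[X])%E]/(\1_(\bigcap_(i in [set` J]) (X i @^-1` A i))).
  rewrite expectation_indic; last first.
    exact: fin_bigcap_measurable.
  rewrite indX; last by move=> i; case: (AP i).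
  apply: eq_big_seq => i iJ; rewrite (AP i).2//.
  rewrite -(expectation_indic P (mA i)).
  by congr ('E_P[_])%E; apply/funext => t /=; rewrite !indicE.
have [iJ|iJ] := boolP (i \in J); last first.
  apply: IHs => // j jJ js; apply: indicg => //.
  by rewrite inE negb_or js andbT; apply: contraNneq iJ => <-.
have splitJ (h : I -> R -> R) t : (\prod_(j <- J) h j (X j t) =
    \prod_(j <- J | j != i) h j (X j t) * h i (X i t))%R.
  by rewrite (bigD1_seq i)//= mulrC.
have splitEJ (h : I -> R -> R) : (\prod_(j <- J) 'E_P[h j \o X j] =
    (\prod_(j <- J | j != i) 'E_P[h j \o X j]) * 'E_P[h i \o X i])%E.
  by rewrite (bigD1_seq i)//= muleC.
under eq_fun do rewrite splitJ.
rewrite splitEJ !EE.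
apply: (ge0_integral_factor (Y := X i)) => //.
- under eq_fun do rewrite -big_filter.
  by apply: measurable_prod => j _; exact: measurableT_comp.
- by move=> t; exact: prodr_ge0.
- by rewrite big_seq_cond; apply: prode_fin_num => j /andP[/fing].
move=> A mA.
(* [h] is the family [g] with its [i]-th factor replaced by an indicator. *)
pose h j := if j == i then \1_A else g j.
have hE j : j != i -> h j = g j by rewrite /h => /negbTE ->.
have hi : h i = \1_A by rewrite /h eqxx.
have IHh : ('E_P[fun t => (\prod_(j <- J) h j (X j t))%R] =
    \prod_(j <- J) 'E_P[h j \o X j])%E.
  apply: IHs.
  - by move=> j; rewrite /h; case: ifP => // _; exact: measurable_indic.
  - by move=> j y; rewrite /h; case: ifP => // _; rewrite indicE.
  - move=> j jJ; have [->|/hE->] := eqVneq j i; last exact: fing.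
    rewrite hi (_ : _ \o _ = \1_(X i @^-1` A)); last first.
      by apply/funext => t /=; rewrite !indicE.
    by rewrite expectation_indic ?fin_num_measure//; exact: mX.
  - move=> j jJ js; have [->|ji] := eqVneq j i; first by exists A.
    by rewrite hE//; apply: indicg => //; rewrite inE negb_or ji.
rewrite (eq_bigr (fun j => 'E_P[h j \o X j])%E); last by move=> j /hE->.
rewrite -hi -(EE (h i \o X i)) -splitEJ -IHh EE.
apply: eq_integral => t _; rewrite splitJ; congr (_ * _)%:E.
by apply: eq_bigr => j /hE->.
Qed.
End ExpectationProduct.

(** * Moments of a single return *)

Section Moments.
Context {d : measure_display} {T : measurableType d} {R : realType}.
Variable P : probability T R.

Lemma Lfun2_sqr_lty (f : T -> R) : measurable_fun [set: T] f ->
  (\int[P]_t (f t ^+ 2)%:E < +oo)%E -> f \in Lfun P 2%:E.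
Proof.
move=> mf f2; rewrite inE; apply/andP; split; rewrite inE//=.
rewrite /finite_norm unlock poweR_lty//=.
by under eq_integral do rewrite powR_mulrn// real_normK ?num_real//.
Qed.

Lemma Lfun2_ae_bounded (Y : {RV P >-> R}) (m M : R) :
  {ae P, forall t, m <= Y t <= M} -> (Y : T -> R) \in Lfun P 2%:E.
Proof.
move=> Ybd; apply: Lfun2_sqr_lty => //.
pose C := m ^+ 2 + M ^+ 2.
apply: (@le_lt_trans _ _ (\int[P]_t (cst C%:E t))%E); last first.
  by rewrite integral_cst//= probability_setT mule1 ltry.
apply: ae_ge0_le_integral => //.
- by move=> t _; rewrite lee_fin sqr_ge0.
- by apply/measurable_EFinP; exact: measurable_funX.
- by move=> t _; rewrite lee_fin addr_ge0 ?sqr_ge0.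
- apply: filterS Ybd => t /andP[mY YM] _; rewrite lee_fin /C.
  by have [Y0|Y0] := leP 0 (Y t); nra.
Qed.

Lemma expectation_affine_mul (Y : {RV P >-> R}) (mu s2 a b : R) :
  (Y : T -> R) \in Lfun P 2%:E -> ('E_P[Y] = mu%:E)%E -> ('V_P[Y] = s2%:E)%E ->
  ('E_P[fun t => (1 + a * Y t) * (1 + b * Y t)]%R =
   (1 + (a + b) * mu + a * b * (s2 + mu ^+ 2))%R%:E)%E.
Proof.
move=> Y2 EY VY.
have Pfin : P setT \is a fin_num := fin_num_measure P _ measurableT.
have Y1 := Lfun_subset12 Pfin Y2.
have YY1 := Lfun2_mul_Lfun1 Y2 Y2.
have EYY : ('E_P[(Y : T -> R) \* Y] = (s2 + mu ^+ 2)%:E)%E.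
  move: VY; rewrite varianceE// EY -EFin_expe.
  rewrite -[X in ('E_P[X] - _)%E]/((Y : T -> R) \* Y).
  by rewrite -(fineK (expectation_fin_num YY1)) -EFinB => -[<-]; rewrite subrK.
rewrite (_ : (fun t => _) = cst 1 \+ ((a + b) \o* (Y : T -> R)
    \+ (a * b) \o* ((Y : T -> R) \* Y))); last first.
  by apply/funext => t /=; ring.
have aY1 : (a + b) \o* (Y : T -> R) \in Lfun P 1 by exact: Lfun_scale.
have abYY1 : (a * b) \o* ((Y : T -> R) \* Y) \in Lfun P 1.
  exact: Lfun_scale.
rewrite !expectationD ?Lfun_cst ?rpredD//= !expectationZl//.
rewrite expectation_cst EY EYY -!EFinM -!EFinD addrA//.
Qed.
End Moments.

(** * Products of growth factors *)

Section Growth.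
Context {d : measure_display} {T : measurableType d} {R : realType}.
Variables (P : probability T R) (X : nat -> {RV P >-> R}) (mu s2 : R).
Hypotheses (indX : mutually_independent X)
  (X2 : forall j, (X j : T -> R) \in Lfun P 2%:E)
  (EX : forall j, ('E_P[X j] = mu%:E)%E) (VX : forall j, ('V_P[X j] = s2%:E)%E).

Definition growth (a : nat -> R) k (t : T) : R :=
  \prod_(0 <= j < k) (1 + a j * X j t).

(** With probability one no single period turns the account value negative. *)
Definition ae_solvent (a : nat -> R) : Prop :=
  {ae P, forall t, forall j, 0 <= 1 + a j * X j t}.

Lemma measurable_growth a k : measurable_fun [set: T] (growth a k).
Proof.
apply: measurable_prod => j _.
by apply: measurable_funD => //; exact: measurable_funM.
Qed.

(** Solvency of both weights makes each factor
    [(1 + a j X j) (1 + b j X j)] almost surely equal to its absolute value,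
    to which the product formula for nonnegative functions applies. *)
Lemma expectation_growth_mul a b k : ae_solvent a -> ae_solvent b ->
  ('E_P[growth a k \* growth b k]%R =
   (\prod_(0 <= j < k)
      (1 + (a j + b j) * mu + a j * b j * (s2 + mu ^+ 2)))%R%:E)%E.
Proof.
move=> a0 b0.
pose J := [fset j in iota 0 k]%fset.
have J_iota : perm_eq (enum_fset J) (index_iota 0 k).
  apply: uniq_perm; rewrite ?fset_uniq ?iota_uniq// => j.
  by rewrite /index_iota subn0; exact: in_fset.
pose g j y := (1 + a j * y) * (1 + b j * y).
have mg j : measurable_fun [set: R] (g j).
  by apply: measurable_funM; apply: measurable_funD => //; exact: measurable_funM.
have g0 : {ae P, forall t, forall j, 0 <= g j (X j t)}.
  by apply: filterS2 a0 b0 => t a0 b0 j; rewrite mulr_ge0.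
have mgX j : measurable_fun [set: T] (g j \o X j).
  exact: measurableT_comp.
have mNg j : measurable_fun [set: R] (Num.norm \o g j : R -> R).
  exact: measurableT_comp (@normr_measurable R setT) (mg j).
have mNgX j : measurable_fun [set: T] ((Num.norm \o g j) \o X j).
  exact: measurableT_comp.
have Eg j : ('E_P[Num.norm \o g j \o X j] =
    (1 + (a j + b j) * mu + a j * b j * (s2 + mu ^+ 2))%R%:E)%E.
  rewrite -(expectation_affine_mul (a j) (b j) (X2 j) (EX j) (VX j)) unlock.
  apply: ae_eq_integral => //.
  - exact/measurable_EFinP/mNgX.
  - by apply/measurable_EFinP/mgX.
  - by apply: filterS g0 => t g0 _ /=; rewrite ger0_norm// g0.
transitivity ('E_P[fun t => \prod_(j <- J) (Num.norm \o g j) (X j t)]%R)%E.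
  rewrite unlock; apply: ae_eq_integral => //.
  - by apply/measurable_EFinP; apply: measurable_funM; exact: measurable_growth.
  - by apply/measurable_EFinP; apply: measurable_prod => j _; exact: mNgX.
  - apply: filterS g0 => t g0 _ /=; rewrite (perm_big _ J_iota)/=.
    rewrite -big_split/=; congr EFin; apply: eq_bigr => j _.
    by rewrite ger0_norm ?g0.
transitivity (\prod_(j <- J) 'E_P[Num.norm \o g j \o X j])%E.
  apply: (ge0_expectation_prod (f := fun j => Num.norm \o g j) indX) => //.
  - by move=> j y; exact: normr_ge0.
  - by move=> j _; rewrite Eg.
by rewrite (perm_big _ J_iota)/= -prodEFin; apply: eq_bigr => j _; exact: Eg.
Qed.

Lemma growth_Lfun2 a k : ae_solvent a -> growth a k \in Lfun P 2%:E.
Proof.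
move=> a0; apply: Lfun2_sqr_lty; first exact: measurable_growth.
have := expectation_growth_mul k a0 a0; rewrite unlock.
by under eq_integral do rewrite /= -expr2; move=> ->; rewrite ltry.
Qed.

(** The weight [0] has growth [1], so this is a product of two growths. *)
Lemma expectation_growth a k : ae_solvent a ->
  ('E_P[growth a k] = (\prod_(0 <= j < k) (1 + a j * mu))%R%:E)%E.
Proof.
move=> a0.
have s0 : ae_solvent (fun=> 0).
  by apply: filterS a0 => t _ j; rewrite mul0r addr0.
have := expectation_growth_mul k a0 s0.
rewrite (_ : _ \* _ = growth a k); last first.
  apply/funext => t /=; rewrite [X in _ * X]big1 ?mulr1// => j _.
  by rewrite mul0r addr0.
move=> ->; congr EFin; apply: eq_bigr => j _.
by rewrite mulr0 mul0r !addr0.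
Qed.

Lemma covariance_growth a b k : ae_solvent a -> ae_solvent b ->
  (covariance P (growth a k) (growth b k) =
   (\prod_(0 <= j < k)
      (1 + (a j + b j) * mu + a j * b j * (s2 + mu ^+ 2))
    - (\prod_(0 <= j < k) (1 + a j * mu))
      * \prod_(0 <= j < k) (1 + b j * mu))%R%:E)%E.
Proof.
move=> a0 b0.
have Pfin : P setT \is a fin_num := fin_num_measure P _ measurableT.
have A2 := growth_Lfun2 k a0; have B2 := growth_Lfun2 k b0.
rewrite covarianceE ?Lfun2_mul_Lfun1 ?(Lfun_subset12 Pfin)//.
by rewrite expectation_growth_mul// !expectation_growth// EFinB EFinM.
Qed.

End Growth.

(** * The double linear policy *)

Section Accounts.
Context {R : realType}.
Implicit Types (w x : nat -> R).

Lemma long_accountE (V0 alpha : R) w x k :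
  long_account V0 alpha w x k =
  alpha * V0 * \prod_(0 <= j < k) (1 + w j * x j).
Proof.
elim: k => [|k IHk] /=; first by rewrite big_geq// mulr1.
by rewrite IHk big_nat_recr//=; ring.
Qed.

Lemma short_accountE (V0 alpha : R) w x k :
  short_account V0 alpha w x k =
  (1 - alpha) * V0 * \prod_(0 <= j < k) (1 + - w j * x j).
Proof.
elim: k => [|k IHk] /=; first by rewrite big_geq// mulr1.
by rewrite IHk big_nat_recr//=; ring.
Qed.

(** With [0 <= w], the long factor is bounded below by means of [w <= 1] and
    [-1 < x], the short one by means of [w * Xmax <= 1]. *)
Lemma admissible_growth_factor_ge0 (Xmin Xmax w x : R) :
  -1 < Xmin -> 0 < Xmax -> admissible_weights Xmax w ->
  Xmin <= x <= Xmax -> (0 <= 1 + w * x) /\ (0 <= 1 + - w * x).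
Proof.
move=> Xmin1 Xmax0; rewrite /admissible_weights /max_weight /= in_itv/=.
rewrite le_min => /and3P[w0 w1]; rewrite ler_pdivlMr// => wX /andP[mx xM].
by split; nra.
Qed.

End Accounts.

Theorem mainTheorem2 (d : measure_display) (T : measurableType d)
    (R : realType) (P : probability T R)
    (S X : nat -> {RV P >-> R}) (Xmin Xmax mu sigma : R)
    (S_gt0 : forall k t, 0 < S k t)
    (X_return : forall k t, X k t = per_period_return (fun j => S j t) k)
    (Xmin_gtN1 : -1 < Xmin) (Xmin_lt0 : Xmin < 0) (Xmax_gt0 : 0 < Xmax)
    (X_bounded : {ae P, forall t, forall k, Xmin <= X k t <= Xmax})
    (Xmin_support : forall k, support_RV (X k) Xmin)
    (Xmax_support : forall k, support_RV (X k) Xmax)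
    (X_independent : mutually_independent X)
    (X_mean : forall k, ('E_P[X k] = mu%:E)%E)
    (X_variance : forall k, ('V_P[X k] = (sigma ^+ 2)%:E)%E)
    (sigma2_gt0 : 0 < sigma ^+ 2)
    (V0 : R) (V0_gt0 : 0 < V0)
    (alpha : R) (alpha_in01 : 0 < alpha < 1)
    (w : nat -> R) (w_admissible : forall k, admissible_weights Xmax (w k))
    (k : nat) (k_gt0 : (0 < k)%N) :
  ('V_P[fun t => gain_loss V0 alpha w k (fun j => X j t)] =
   (V0 ^+ 2 *
     (alpha ^+ 2
        * \prod_(0 <= j < k) (w j ^+ 2 * sigma ^+ 2 + (1 + w j * mu) ^+ 2)
      + (1 - alpha) ^+ 2
        * \prod_(0 <= j < k) (w j ^+ 2 * sigma ^+ 2 + (1 - w j * mu) ^+ 2)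
      + 2 * alpha * (1 - alpha)
        * \prod_(0 <= j < k) (1 - w j ^+ 2 * (sigma ^+ 2 + mu ^+ 2))
      - 2 * alpha * (1 - alpha)
        * \prod_(0 <= j < k) (1 - w j ^+ 2 * mu ^+ 2)
      - alpha ^+ 2 * \prod_(0 <= j < k) (1 + w j * mu) ^+ 2
      - (1 - alpha) ^+ 2 * \prod_(0 <= j < k) (1 - w j * mu) ^+ 2))%R%:E)%E.
Proof.
have X2 j : (X j : T -> R) \in Lfun P 2%:E.
  apply: (@Lfun2_ae_bounded _ _ _ _ _ Xmin Xmax).
  by apply: filterS X_bounded => t; apply.
have long_ge0 : ae_solvent X w.
  apply: filterS X_bounded => t Xt j.
  by have [] := admissible_growth_factor_ge0 Xmin_gtN1 Xmax_gt0
    (w_admissible j) (Xt j).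
have short_ge0 : ae_solvent X (fun j => - w j).
  apply: filterS X_bounded => t Xt j.
  by have [] := admissible_growth_factor_ge0 Xmin_gtN1 Xmax_gt0
    (w_admissible j) (Xt j).
pose A := growth X w k; pose B := growth X (fun j => - w j) k.
have -> : (fun t => gain_loss V0 alpha w k (fun j => X j t)) =
    (((alpha * V0) \o* A) \+ (((1 - alpha) * V0) \o* B)) \- cst V0.
  apply/funext => t.
  rewrite /gain_loss /account_value long_accountE short_accountE /=.
  by rewrite /A /B /growth; ring.
have A2 : A \in Lfun P 2%:E by exact: growth_Lfun2 X_variance _ _ _.
have B2 : B \in Lfun P 2%:E by exact: growth_Lfun2 X_variance _ _ _.
have Pfin : P setT \is a fin_num := fin_num_measure P _ measurableT.
have A1 := Lfun_subset12 Pfin A2; have B1 := Lfun_subset12 Pfin B2.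
have AB1 := Lfun2_mul_Lfun1 A2 B2.
have cA2 : (alpha * V0) \o* A \in Lfun P 2%:E.
  by apply: Lfun_scale => //; rewrite ler1n.
have cB2 : ((1 - alpha) * V0) \o* B \in Lfun P 2%:E.
  by apply: Lfun_scale => //; rewrite ler1n.
rewrite varianceB_cst_r ?rpredD ?lee1n// varianceD// !varianceZ//.
rewrite covarianceZl ?covarianceZr//; last 2 first.
- by apply: Lfun_scale.
- by apply: Lfun2_mul_Lfun1.
rewrite /variance !(covariance_growth X_independent X2 X_mean X_variance)//.
rewrite -!EFinM -!EFinD; congr EFin.
have varL : \prod_(0 <= j < k) (1 + (w j + w j) * mu +
      w j * w j * (sigma ^+ 2 + mu ^+ 2)) =
    \prod_(0 <= j < k) (w j ^+ 2 * sigma ^+ 2 + (1 + w j * mu) ^+ 2).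
  by apply: eq_bigr => j _; ring.
have varS : \prod_(0 <= j < k) (1 + (- w j + - w j) * mu +
      - w j * - w j * (sigma ^+ 2 + mu ^+ 2)) =
    \prod_(0 <= j < k) (w j ^+ 2 * sigma ^+ 2 + (1 - w j * mu) ^+ 2).
  by apply: eq_bigr => j _; ring.
have varLS : \prod_(0 <= j < k) (1 + (w j + - w j) * mu +
      w j * - w j * (sigma ^+ 2 + mu ^+ 2)) =
    \prod_(0 <= j < k) (1 - w j ^+ 2 * (sigma ^+ 2 + mu ^+ 2)).
  by apply: eq_bigr => j _; ring.
have meanS : \prod_(0 <= j < k) (1 + - w j * mu) =
    \prod_(0 <= j < k) (1 - w j * mu).
  by apply: eq_bigr => j _; rewrite mulNr.
have meanLS : \prod_(0 <= j < k) (1 - w j ^+ 2 * mu ^+ 2) =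
    (\prod_(0 <= j < k) (1 + w j * mu)) * \prod_(0 <= j < k) (1 - w j * mu).
  by rewrite -big_split/=; apply: eq_bigr => j _; ring.
rewrite varL varS varLS meanS meanLS !prodrXl.
ring.
Qed.
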